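(* For every $n\ge 1$ we have $tt(n)\le 12$.
   Context: A permutation is any finite sequence of distinct positive integers; an $n$-permutation is a permutation of $[n]=\{1,\dots,n\}$. Two permutations $(x_1,\dots,x_k)$ and $(y_1,\dots,y_k)$ are similar if $x_i<x_j \iff y_i<y_j$ for all $1\le i<j\le k$. A pair of twins in $\pi$ is a pair of similar subsequences of $\pi$ with disjoint index sets; its length is the number of entries of one of them. A pair of twins is tight if the union of their index sets is a segment of consecutive integers. $tt(\pi)$ is the maximum length of a pair of tight twins in $\pi$ and $tt(n)=\min\{tt(\pi):\pi\text{ an } n\text{-permutation}\}$. *)

(* Defs.v *)
From mathcomp Require Import all_boot.

Set Implicit Arguments.
Unset Strict Implicit.
Unset Printing Implicit Defensive.

(* Positions in a sequence are counted from 0, entries of an n-permutation are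
   1, ..., n. *)
Definition is_permutation (p : seq nat) : bool := uniq p && all (leq 1) p.

Definition is_n_permutation (n : nat) (p : seq nat) : bool :=
  is_permutation p && (perm_eq p (iota 1 n)).

Definition similar (x y : seq nat) : bool :=
  (size x == size y) &&
  [forall i : 'I_(size x), forall j : 'I_(size x),
     (i < j) ==> ((nth 0 x i < nth 0 x j) == (nth 0 y i < nth 0 y j))].

(* [enum] lists the positions in A in increasing order. *)
Definition subsequence (p : seq nat) (A : {set 'I_(size p)}) : seq nat :=
  [seq nth 0 p (i : 'I_(size p)) | i <- enum A].

Definition twins (p : seq nat) (A B : {set 'I_(size p)}) : bool :=
  [disjoint A & B] && similar (subsequence A) (subsequence B).

Definition segment (m : nat) (A : {set 'I_m}) : bool :=
  [exists a : 'I_m.+1, exists b : 'I_m.+1,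
     A == [set k : 'I_m | (a <= k) && (k < b)]].

Definition tight_twins (p : seq nat) (A B : {set 'I_(size p)}) : bool :=
  twins A B && segment (A :|: B).

(* The empty pair counts as tight twins of length 0, so the maximum is over a
   nonempty set even when p has a single entry. *)
Definition tt_perm (p : seq nat) : nat :=
  \max_(AB : {set 'I_(size p)} * {set 'I_(size p)} | tight_twins AB.1 AB.2)
    #|AB.1|.

Lemma tt_value_exists (n : nat) :
  exists k, has (fun p => is_n_permutation n p && (tt_perm p == k))
                (permutations (iota 1 n)).
Proof.
exists (tt_perm (iota 1 n)); apply/hasP; exists (iota 1 n).
  by rewrite mem_permutations.
rewrite /is_n_permutation /is_permutation iota_uniq perm_refl eqxx /= !andbT.
by apply/allP => i; rewrite mem_iota => /andP[].
Qed.

(* [permutations (iota 1 n)] enumerates all n-permutations. *)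
Definition tt_min (n : nat) : nat := ex_minn (tt_value_exists n).

Lemma tt_minP (n : nat) :
  (exists2 p, is_n_permutation n p & tt_perm p = tt_min n) /\
  (forall p, is_n_permutation n p -> tt_min n <= tt_perm p).
Proof.
rewrite /tt_min; case: ex_minnP => k /hasP[p _ /andP[pP /eqP pk]] kmin; split.
  by exists p.
move=> q qP; apply: kmin; apply/hasP; exists q; last by rewrite qP eqxx.
by rewrite mem_permutations; case/andP: qP.
Qed.

(* Main.v *)
(** Counting in the style of Rosenfeld, in place of the local lemma.  Let [g m] be
    the number of permutations of [N] positions whose first [m] entries contain
    no tight twins of length more than 12.  If position [m] creates such twins,
    they fill the last [2k] of the first [m + 1] positions for some [k > 12], and
    the first [m + 1 - 2k] entries were free of them.  Of the [k!] rearrangements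
    of one twin at most one is similar to the other, so
    [g m <= g (m + 1) + \sum_(k > 12) C(2k, k) / k! * g (m + 1 - 2k)].
    Since [C(2k, k) / k!] is tiny for [k > 12], induction on [m] gives
    [9/10 * g m <= g (m + 1)]; hence [g N > 0]. *)
From mathcomp Require Import all_boot.
From mathcomp Require Import all_order all_algebra all_fingroup.
From mathcomp Require Import ring lra zify.
Require Import Defs.

Set Implicit Arguments.
Unset Strict Implicit.
Unset Printing Implicit Defensive.

Import Order.TTheory GRing.Theory Num.Theory.

(** * Ranks and rigidity of similarity *)

Lemma count_ltn_inj (x : seq nat) (a b : nat) :
  a \in x -> b \in x -> count (gtn a) x = count (gtn b) x -> a = b.
Proof.
wlog le_ab : a b / a <= b => [wlog_ab ax bx eq_ab|ax _ eq_ab].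
  by case/orP: (leq_total a b) => le; [|symmetry]; apply: wlog_ab.
apply/eqP; rewrite eqn_leq le_ab leqNgt; apply/negP => lt_ab.
suff : count (gtn a) x < count (gtn b) x by rewrite eq_ab ltnn.
have a_gt0 : 0 < count (pred1 a) x by rewrite -has_count has_pred1.
have := count_predUI (gtn a) (pred1 a) x.
rewrite (@eq_count _ (predI _ _) pred0) ?count_pred0 ?addn0; last first.
  by move=> i /=; apply/negbTE/andP => -[/[swap]/eqP->]; rewrite ltnn.
move=> cntU; apply: (@leq_trans (count (predU (gtn a) (pred1 a)) x)).
  by rewrite cntU -addn1 leq_add2l.
by apply: sub_count => i /= /orP[ia|/eqP->//]; apply: ltn_trans lt_ab.
Qed.

Lemma similar_size (x y : seq nat) : similar x y -> size x = size y.
Proof. by case/andP => /eqP. Qed.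

Lemma similar_nth (x y : seq nat) (i j : nat) : similar x y ->
  i < j < size x -> (nth 0 x i < nth 0 x j) = (nth 0 y i < nth 0 y j).
Proof.
case/andP => _ /forallP xy /andP[ij jx].
have /forallP/(_ (Ordinal jx))/implyP := xy (Ordinal (ltn_trans ij jx)).
by move=> /(_ ij)/eqP.
Qed.

(** The common [y] prescribes every comparison between two positions, so [x] and [x'] have equal
    ranks position by position. As both have the same set of entries, the rank determines the
    entry. *)
Lemma similar_perm_inj (x x' y : seq nat) :
  uniq x -> perm_eq x x' -> similar x y -> similar x' y -> x = x'.
Proof.
move=> ux xx' sx sx'; have ux' : uniq x' by rewrite -(perm_uniq xx').
have szx := perm_size xx'.
have cmp i j : i < size x -> j < size x ->
    (nth 0 x i < nth 0 x j) = (nth 0 x' i < nth 0 x' j).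
  move=> ix jx; case: (ltngtP i j) => [ij|ji|->]; last by rewrite !ltnn.
    by rewrite (similar_nth sx) ?ij // (similar_nth sx') ?ij -?szx.
  (* Similarity compares only an earlier position with a later one; distinctness of the entries
     reverses the comparison. *)
  have := similar_nth sx (i := j) (j := i); rewrite ji ix => /(_ isT).
  rewrite -(similar_nth sx') ?ji -?szx // => E.
  have neq : (nth 0 x i == nth 0 x j) = false.
    by rewrite nth_uniq //; apply/eqP => eij; rewrite eij ltnn in ji.
  have neq' : (nth 0 x' i == nth 0 x' j) = false.
    by rewrite nth_uniq -?szx //; apply/eqP => eij; rewrite eij ltnn in ji.
  by rewrite ltn_neqAle neq leqNgt E -leqNgt leq_eqVlt neq'.
apply: (@eq_from_nth _ 0) => // i ix.
apply: (@count_ltn_inj x); first exact: mem_nth.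
  by rewrite (perm_mem xx') mem_nth -?szx.
rewrite [RHS](seq.permP xx').
have countE (z : seq nat) a : count (gtn a) z =
    count (fun j => nth 0 z j < a) (iota 0 (size z)).
  by rewrite -{1}(mkseq_nth 0 z) count_map.
rewrite !countE -szx; apply: eq_in_count => j; rewrite mem_iota => /= jx.
by rewrite cmp.
Qed.

(** * Permutations whose prefixes avoid long tight twins *)

Section TwinFreePrefixes.

Variables (N l : nat).
Implicit Types (s t : {perm 'I_N}) (A B : {set 'I_N}).

Definition entries s A : seq nat := [seq (s i).+1 | i <- enum A].

Definition block (a b : nat) : {set 'I_N} := [set k : 'I_N | a <= k < b].

Definition has_tight_twins s (a b : nat) : bool :=
  [exists A : {set 'I_N}, exists B : {set 'I_N},
    [&& [disjoint A & B], A :|: B == block a b, l < #|A|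
      & similar (entries s A) (entries s B)]].

(** Whole permutations rather than prefixes are collected: the sets decrease with [m], and
    rearranging positions from [m] on preserves membership. *)
Definition twin_free (m : nat) : {set {perm 'I_N}} :=
  [set s | [forall a : 'I_m.+1, forall b : 'I_m.+1, ~~ has_tight_twins s a b]].

Lemma twin_freeP m s :
  reflect (forall a b, a <= m -> b <= m -> ~~ has_tight_twins s a b)
          (s \in twin_free m).
Proof.
rewrite inE; apply: (iffP forallP) => [tf a b am bm|tf a].
  by have /forallP/(_ (Ordinal (bm : b < m.+1))) := tf (Ordinal (am : a < m.+1)).
by apply/forallP => b; apply: tf; rewrite -ltnS.
Qed.

Lemma size_entries s A : size (entries s A) = #|A|.
Proof. by rewrite size_map -cardE. Qed.

Lemma eq_entries s t A : {in A, s =1 t} -> entries s A = entries t A.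
Proof. by move=> st; apply/eq_in_map => i; rewrite mem_enum => /st->. Qed.

Lemma uniq_entries s A : uniq (entries s A).
Proof. by rewrite map_inj_uniq ?enum_uniq // => i j [/val_inj/perm_inj]. Qed.

Lemma perm_entries s t A : perm_on A t ->
  perm_eq (entries s A) (entries (t * s)%g A).
Proof.
move=> tA; apply: uniq_perm; rewrite ?uniq_entries // => x.
apply/mapP/mapP => -[i]; rewrite mem_enum => iA ->.
  exists (t^-1%g i); last by rewrite permM permKV.
  by rewrite mem_enum -(perm_closed _ tA) permKV.
by exists (t i); rewrite ?permM // mem_enum perm_closed.
Qed.

Lemma eq_has_tight_twins s t a b :
  {in block a b, s =1 t} -> has_tight_twins s a b = has_tight_twins t a b.
Proof.
move=> st; apply: eq_existsb => A; apply: eq_existsb => B.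
case: eqP => [AB|_]; last by rewrite !andbF.
rewrite (@eq_entries s t A) ?(@eq_entries s t B) // => i iX; apply: st;
  by rewrite -AB inE iX ?orbT.
Qed.

Lemma twin_free_le m m' : m <= m' -> twin_free m' \subset twin_free m.
Proof.
move=> mm'; apply/subsetP => s /twin_freeP tf; apply/twin_freeP => a b am bm.
by apply: tf; exact: leq_trans mm'.
Qed.

Lemma card_block a b : b <= N -> #|block a b| = b - a.
Proof.
move=> bN; rewrite cardE -(size_map val) -[RHS](size_iota a); apply/perm_size/uniq_perm.
- by rewrite (map_inj_uniq val_inj) enum_uniq.
- exact: iota_uniq.
move=> k; rewrite mem_iota; apply/mapP/idP => [[i]|akb].
  by rewrite mem_enum inE => ? -> /=; lia.
have kN : k < N by lia.
by exists (Ordinal kN) => //; rewrite mem_enum inE /=; lia.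
Qed.

Definition twin_set (m : nat) A B : {set {perm 'I_N}} :=
  [set s in twin_free m | similar (entries s A) (entries s B)].

(* Permuting the positions in [A] changes neither the first [m] entries nor those
   at [B], and at most one of the [#|A|`!] rearrangements at [A] is similar to
   the subsequence at [B]. *)
Lemma card_twin_set m A B : [disjoint A & B] -> A \subset [set i : 'I_N | m <= i] ->
  #|A|`! * #|twin_set m A B| <= #|twin_free m|.
Proof.
move=> dAB /subsetP Am.
have -> : #|A|`! = #|[set t | perm_on A t]| by rewrite cardsE card_perm.
rewrite mulnC -cardsX.
(* Products act left to right, so [t * s] lists the entries of [s] at positions rearranged by
   [t]. *)
pose f (u : {perm 'I_N} * {perm 'I_N}) := (u.2 * u.1)%g.
have B_out t : perm_on A t -> {in B, t =1 id}.
  by move=> tA i iB; apply: (out_perm tA); rewrite (disjointFl dAB).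
(* Injectivity: equal products give equal entries at [B], hence equal entries at [A] by rigidity, so
   [t'^-1 * t] fixes [A] pointwise. *)
rewrite -(@card_in_imset _ _ f); last first.
  move=> [s t] [s' t']; rewrite !inE /f /=.
  case/andP=> /andP[_ ss] tA /andP[/andP[_ ss'] tA'] E.
  have EB : entries s B = entries s' B.
    apply: eq_entries => i iB; have /permP/(_ i) := E.
    by rewrite !permM (B_out _ tA) // (B_out _ tA').
  have E' : s' = (t'^-1 * t * s)%g by rewrite -mulgA E mulKg.
  have rA : perm_on A (t'^-1 * t)%g by apply: perm_onM => //; apply: perm_onV.
  have EA : entries s A = entries s' A.
    apply: (similar_perm_inj (uniq_entries s A) _ ss); last by rewrite EB.
    by rewrite E'; apply: perm_entries.
  suff tt' : (t'^-1 * t)%g = 1%g.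
    have e : t = t' by rewrite -[t](mulKVg t') tt' mulg1.
    by rewrite E' tt' mul1g e.
  apply/permP => i; rewrite perm1.
  have [iA|/(out_perm rA)//] := boolP (i \in A).
  apply: (@perm_inj _ s); rewrite -permM -E'.
  have /eq_in_map/(_ i) := EA; rewrite mem_enum => /(_ iA)[].
  by move/val_inj.
apply: subset_leq_card; apply/subsetP => _ /imsetP[[s t] + ->].
rewrite !inE /f /= -andbA => /and3P[+ _ tA].
have -> : [forall a : 'I_m.+1, forall b : 'I_m.+1, ~~ has_tight_twins s a b]
  = (s \in twin_free m) by rewrite inE.
move=> /twin_freeP tf; apply/forallP => a; apply/forallP => b.
rewrite (@eq_has_tight_twins _ s); first by apply: tf; rewrite -ltnS.
move=> i; rewrite inE => /andP[_ ib]; rewrite permM (out_perm tA) //.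
apply/negP => /Am; rewrite inE; have := ltn_ord b; lia.
Qed.

Lemma twin_free_step m : m < N ->
  twin_free m :\: twin_free m.+1 \subset
  \bigcup_(k < m.+1./2.+1 | l < k)
    \bigcup_(A in [set A : {set 'I_N} |
                     (A \subset block (m.+1 - k.*2) m.+1) && (#|A| == k)])
      twin_set (m.+1 - k.*2) A (block (m.+1 - k.*2) m.+1 :\: A).
Proof.
move=> mN; apply/subsetP => s; rewrite inE => /andP[nf fm].
have [a [b [am bm]]] : exists a b, [/\ a <= m.+1, b <= m.+1 & has_tight_twins s a b].
  move: nf; rewrite inE negb_forall => /existsP[a]; rewrite negb_forall.
  move=> /existsP[b]; rewrite negbK => tw; exists a, b.
  by split => //; rewrite -ltnS.
have tf := twin_freeP _ _ fm.
move=> tw; have /existsP[A /existsP[B /and4P[dAB /eqP AB lA sAB]]] := tw.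
have cA : #|A| = #|B| by rewrite -(size_entries s) (similar_size sAB) size_entries.
have cI : #|A| + #|B| = b - a.
  rewrite -card_block ?(leq_trans bm) // -AB cardsU.
  by rewrite (disjoint_setI0 dAB) cards0 subn0.
(* Twins ending earlier would already lie in the twin-free prefix of length [m]. *)
have bE : b = m.+1.
  apply/eqP; rewrite eqn_leq bm ltnNge; apply/negP => bm'.
  have := tf a b; rewrite tw bm' => /(_ _ isT) H.
  have : a <= m by lia.
  by move/H.
subst b.
have kb : #|A| < m.+1./2.+1 by lia.
have aE : m.+1 - #|A|.*2 = a by lia.
apply/bigcupP; exists (Ordinal kb) => //=; rewrite aE.
have BE : block a m.+1 :\: A = B.
  by rewrite -AB setDUl setDv set0U; apply/setDidPl; rewrite disjoint_sym.
apply/bigcupP; exists A.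
  by rewrite inE eqxx andbT -AB subsetUl.
(* Only the prefix before the twins is retained, since [card_twin_set] needs [A] to lie beyond
   it. *)
rewrite BE inE sAB andbT; apply: (subsetP (twin_free_le _)) fm.
lia.
Qed.

End TwinFreePrefixes.

(** * The recurrence and the growth of its solutions *)

Local Open Scope ring_scope.

Lemma leq_card_bigcup (I T : finType) (P : pred I) (F : I -> {set T}) :
  (#|\bigcup_(i | P i) F i| <= \sum_(i | P i) #|F i|)%N.
Proof.
elim/big_rec2: _ => [|i n A _ le_An]; first by rewrite cards0.
by apply: leq_trans (leq_card_setU _ _) _; rewrite leq_add2l.
Qed.

Section TwinFreeGrowth.

Variable R : realFieldType.

(** A union bound over [k] and [A]: one twin determines the other as its complement in the last
    [k.*2] positions, which leaves ['C(k.*2, k)] choices. *)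
Lemma card_twin_free_rec (N l m : nat) : (m < N)%N ->
  #|twin_free N l m|%:R <= #|twin_free N l m.+1|%:R +
    \sum_(k < m.+1./2.+1 | (l < k)%N)
      'C(k.*2, k)%:R / (k`!)%:R * #|twin_free N l (m.+1 - k.*2)|%:R :> R.
Proof.
move=> mN; set T := twin_free N l.
have : (#|T m| <= #|T m.+1| + #|T m :\: T m.+1|)%N.
  by rewrite -(cardsID (T m.+1) (T m)) leq_add2r subset_leq_card ?subsetIr.
rewrite -(ler_nat R) natrD => /le_trans; apply; rewrite lerD2l.
have /subset_leq_card/leq_trans/(_ (leq_card_bigcup _ _)) := twin_free_step l mN.
rewrite -(ler_nat R) => /le_trans; apply; rewrite natr_sum.
apply: ler_sum => k _; set a := (m.+1 - k.*2)%N.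
have km : (k.*2 <= m.+1)%N by have := ltn_ord k; lia.
set I := block N a m.+1.
have cI : #|I| = k.*2 by rewrite card_block // /a; lia.
have le_k A : A \in [set A : {set 'I_N} | (A \subset I) && (#|A| == k)] ->
    #|twin_set l a A (I :\: A)|%:R <= #|T a|%:R / (k`!)%:R :> R.
  rewrite inE => /andP[AI /eqP cA].
  rewrite ler_pdivlMr ?ltr0n ?fact_gt0 // -natrM ler_nat mulnC -cA.
  apply: card_twin_set; first by rewrite disjoint_sym disjoints_subset setDE subsetIr.
  by apply: subset_trans AI _; apply/subsetP => i; rewrite !inE => /andP[].
apply: le_trans (_ : \sum_(A in [set A : {set 'I_N} | (A \subset I) && (#|A| == k)])
    #|T a|%:R / (k`!)%:R <= _).
  apply: le_trans (ler_sum _ le_k); rewrite -natr_sum ler_nat.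
  exact: leq_card_bigcup.
by rewrite sumr_const cards_draws cI -[leLHS]mulr_natr -mulrA mulrC [_^-1 * _]mulrC.
Qed.

(* The factor [(10 / 9) ^+ k.*2] pays for going back from [g m] to
   [g (m.+1 - k.*2)] when [9 / 10 * g j <= g j.+1] for all [j < m]. *)
Definition weight (k : nat) : R := 'C(k.*2, k)%:R / (k`!)%:R * (10 / 9) ^+ k.*2.

Lemma weight_ge0 k : 0 <= weight k.
Proof. by rewrite mulr_ge0 ?exprn_ge0 // mulr_ge0 ?invr_ge0 ?ler0n. Qed.

Lemma weightS k :
  weight k.+1 = weight k * (2 * (2 * k%:R + 1) * (k.+1%:R)^-1 ^+ 2 * (10 / 9) ^+ 2).
Proof.
have k0 : k%:R + 1 != 0 :> R by rewrite natr1 pnatr_eq0.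
have f0 j : (j`!)%:R != 0 :> R by rewrite pnatr_eq0 -lt0n fact_gt0.
have binE j : 'C(j.*2, j)%:R = (j.*2`!)%:R / ((j`!)%:R * (j`!)%:R) :> R.
  have : (j <= j.*2)%N by lia.
  move/bin_fact => /(congr1 (fun n => n%:R : R)).
  rewrite -addnn addnK !natrM addnn => <-.
  by rewrite mulfK // mulf_neq0.
rewrite /weight !binE doubleS 2!factS 2!exprS !factS !natrM.
by rewrite -!natr1 -mul2n natrM; field; rewrite k0 f0.
Qed.

Lemma weight13 : weight 13 <= 1 / 20.
Proof. by rewrite !weightS /weight bin0 fact0 expr0; lra. Qed.

(** From [k = 13] on, the ratio of consecutive weights given by [weightS] is below [1 / 2]. *)
Lemma weight_le j : weight (13 + j) <= 1 / 20 * (1 / 2) ^+ j.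
Proof.
elim: j => [|j IH]; first by rewrite expr0 mulr1 weight13.
have x13 : 13 <= (13 + j)%N%:R :> R by rewrite ler_nat leq_addr.
rewrite addnS weightS [_ ^+ j.+1]exprSr mulrA ler_pM ?weight_ge0 //.
  by rewrite !mulr_ge0 ?addr_ge0 ?mulr_ge0 ?exprn_ge0 ?invr_ge0 ?mulr_ge0 ?invr_ge0 ?ler0n ?ler01.
rewrite -[(13 + j)%N.+1%:R]natr1; set x := (13 + j)%N%:R in x13 *.
rewrite exprVn mulrAC ler_pdivrMr ?exprn_gt0; nra.
Qed.

Lemma sum_weight n : \sum_(k < n | (12 < k)%N) weight k <= 1 / 10.
Proof.
(* The partial geometric sum makes the induction work; truncated subtraction makes both sides zero
   when [n <= 13]. *)
suff : \sum_(k < n | (12 < k)%N) weight k <= 1 / 10 * (1 - (1 / 2) ^+ (n - 13)).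
  move/le_trans; apply; have : 0 <= (1 / 2 : R) ^+ (n - 13) by rewrite exprn_ge0 ?divr_ge0 ?ler0n.
  lra.
rewrite big_mkcond /=; elim: n => [|n IH]; first by rewrite big_ord0 subrr mulr0.
rewrite big_ord_recr /=; have [n13|n13] := ltnP 12 n; last first.
  by rewrite addr0; have -> : (n.+1 - 13 = n - 13)%N by lia.
have -> : (n.+1 - 13 = (n - 13).+1)%N by lia.
have := weight_le (n - 13); rewrite subnKC // exprS; lra.
Qed.

Lemma recurrence_growth (g : nat -> R) (N : nat) :
  (forall m, 0 <= g m) ->
  (forall m, (m < N)%N -> g m <= g m.+1 +
    \sum_(k < m.+1./2.+1 | (12 < k)%N)
      'C(k.*2, k)%:R / (k`!)%:R * g (m.+1 - k.*2)%N) ->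
  forall m, (m < N)%N -> 9 / 10 * g m <= g m.+1.
Proof.
move=> g0 rec m; elim/ltn_ind: m => m IH mN.
(* Iterating the induction hypothesis, each step back costs a factor [10 / 9]. *)
have back i : (i <= m)%N -> g (m - i)%N <= (10 / 9) ^+ i * g m.
  elim: i => [|i IHi] im; first by rewrite subn0 expr0 mul1r.
  have := IHi (ltnW im); have := IH (m - i.+1)%N.
  have -> : ((m - i.+1).+1 = m - i)%N by lia.
  rewrite exprS => H1 H2.
  have : 9 / 10 * g (m - i.+1)%N <= g (m - i)%N by apply: H1; lia.
  move/le_trans/(_ H2); rewrite -mulrA; clear; lra.
suff : \sum_(k < m.+1./2.+1 | (12 < k)%N)
    'C(k.*2, k)%:R / (k`!)%:R * g (m.+1 - k.*2)%N <= 1 / 10 * g m.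
  by have := rec m mN; clear; lra.
apply: le_trans (_ : \sum_(k < m.+1./2.+1 | (12 < k)%N) weight k * g m <= _).
  apply: ler_sum => k k12; rewrite /weight -[leRHS]mulrA ler_wpM2l ?divr_ge0 //.
  have km := ltn_ord k.
  (* From [m] one goes back only [k.*2.-1] steps, so [weight] has one factor [10 / 9] to spare. *)
  have -> : (m.+1 - k.*2 = m - k.*2.-1)%N by lia.
  have k0 : (k.*2 = k.*2.-1.+1)%N by lia.
  apply: le_trans (back _ _) _; first by lia.
  rewrite ler_wpM2r // [in leRHS]k0 exprS ler_peMl ?exprn_ge0 ?divr_ge0 ?ler0n //; clear; lra.
by rewrite -mulr_suml ler_wpM2r ?sum_weight.
Qed.

End TwinFreeGrowth.

Lemma exists_twin_free (N : nat) : exists s, s \in twin_free N 12 N.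
Proof.
suff gt0 m : (m <= N)%N -> 0 < #|twin_free N 12 m|%:R :> rat.
  by have := gt0 N (leqnn N); rewrite ltr0n => /card_gt0P.
elim: m => [_|m IH mN]; last first.
  have gr := recurrence_growth (fun=> ler0n rat _) (@card_twin_free_rec rat N 12).
  have := gr m mN; have := IH (ltnW mN); clear; lra.
(* For [m = 0] any permutation would do: the only block is empty and has no room for twins. *)
rewrite ltr0n; apply/card_gt0P; exists 1%g; apply/twin_freeP => a b.
rewrite leqn0 [(b <= 0)%N]leqn0 => /eqP-> /eqP->; apply/existsP => -[A].
case/existsP => B /and4P[_ /eqP AB lA _].
have : A \subset block N 0 0 by rewrite -AB subsetUl.
by move/subset_leq_card; rewrite card_block //; lia.
Qed.

Local Close Scope ring_scope.

(** * From permutations of positions to words *)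

Lemma enum_cast_ord m n (e : m = n) (A : {set 'I_m}) :
  enum (cast_ord e @: A) = map (cast_ord e) (enum A).
Proof.
case: _ / e; rewrite (eq_map (@cast_ord_id _ _)) map_id.
by rewrite (eq_imset _ (@cast_ord_id _ _)) imset_id.
Qed.

Definition word N (s : {perm 'I_N}) : seq nat := entries s [set: 'I_N].

Lemma size_word N (s : {perm 'I_N}) : size (word s) = N.
Proof. by rewrite size_entries cardsT card_ord. Qed.

Lemma nth_word N (s : {perm 'I_N}) (i : 'I_N) : nth 0 (word s) i = (s i).+1.
Proof.
rewrite /word /entries enum_setT -enumT (nth_map i) ?size_enum_ord //.
by rewrite nth_ord_enum.
Qed.

Lemma word_is_n_permutation N (s : {perm 'I_N}) : is_n_permutation N (word s).
Proof.
have uw := uniq_entries s [set: 'I_N].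
have mw : word s =i iota 1 N.
  move=> k; rewrite mem_iota; apply/mapP/idP => [[i _ ->]|kN].
    by have := ltn_ord (s i); lia.
  have k1 : k.-1 < N by lia.
  by exists (s^-1%g (Ordinal k1)); rewrite ?mem_enum ?inE // permKV /=; lia.
rewrite /is_n_permutation /is_permutation uw uniq_perm ?iota_uniq // andbT.
by apply/allP => k; rewrite mw mem_iota => /andP[].
Qed.

Lemma subsequence_word N (s : {perm 'I_N}) (A : {set 'I_(size (word s))}) :
  subsequence A = entries s (cast_ord (size_word s) @: A).
Proof.
rewrite /entries enum_cast_ord -map_comp; apply: eq_map => i.
by rewrite /= -nth_word.
Qed.

(** Index sets of [word s] live in ['I_(size (word s))], so twins are carried to ['I_N] along
    [cast_ord], which preserves order, size and segments. *)
Lemma tt_perm_word N l (s : {perm 'I_N}) :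
  s \in twin_free N l N -> tt_perm (word s) <= l.
Proof.
move/twin_freeP => tf; apply/bigmax_leqP => -[A B] /= /andP[/andP[dAB sAB]].
case/existsP => a /existsP[b /eqP AB]; rewrite leqNgt; apply/negP => lA.
pose c := cast_ord (size_word s); have c_inj : injective c := @cast_ord_inj _ _ _.
have ordN (k : 'I_(size (word s)).+1) : k <= N.
  by rewrite -[leqRHS](size_word s) -ltnS.
apply/(negP (tf a b (ordN a) (ordN b))).
apply/existsP; exists (c @: A); apply/existsP; exists (c @: B).
rewrite -!subsequence_word sAB andbT card_imset // lA andbT.
rewrite imset_disjoint // dAB -imsetU AB; apply/eqP/setP => i.
rewrite -[i](cast_ordKV (size_word s)) mem_imset //.
by rewrite !inE.
Qed.

Theorem theorem3p6 (n : nat) (hn : 1 <= n) : tt_min n <= 12.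
Proof.
have [s /tt_perm_word] := exists_twin_free n.
exact/leq_trans/(tt_minP n).2/word_is_n_permutation.
Qed.
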